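(* Let $q$ be a prime power and let $n \geq 2$ be an integer. Let $G_{\mathrm{pr}}(\mathbb{F}_q^n)$ be the phase-rotation distance graph, and let $\alpha(G_{\mathrm{pr}}(\mathbb{F}_q^n))$ be its independence number. Then \[ \alpha(G_{\mathrm{pr}}(\mathbb{F}_q^n)) \leq \begin{cases} 2^{n-1}\, \frac{n-1}{n} & \text{if } q=2 \text{ and } n \text{ is even}, \\ q^{n-1} & \text{if } q=2 \text{ and } n \text{ is odd, or } q \geq 3. \end{cases} \]
   Context: Let $\mathbf{e}_1,\ldots,\mathbf{e}_n$ be the standard basis of $\mathbb{F}_q^n$ and $\mathbf{1}$ the all-ones vector. Put $F_i=\mathrm{span}(\mathbf{e}_i)$ for $i=1,\ldots,n$ and $F_{n+1}=\mathrm{span}(\mathbf{1})$. The phase-rotation weight of $\mathbf{x}\in\mathbb{F}_q^n$ is $w_{\mathrm{pr}}(\mathbf{x})=\min\{|I| : I\subseteq\{1,\ldots,n+1\},\ \mathbf{x}\in\mathrm{span}(\bigcup_{i\in I}F_i)\}$, and the phase-rotation distance is $d_{\mathrm{pr}}(\mathbf{x},\mathbf{y})=w_{\mathrm{pr}}(\mathbf{x}-\mathbf{y})$. The phase-rotation distance graph $G_{\mathrm{pr}}(\mathbb{F}_q^n)$ is the graph with vertex set $\mathbb{F}_q^n$ in which $\mathbf{x},\mathbf{y}$ are adjacent if and only if $d_{\mathrm{pr}}(\mathbf{x},\mathbf{y})=1$. The independence number is the maximum size of a set of pairwise non-adjacent vertices. *)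

(* Defs.v *)
From HB Require Import structures.
From mathcomp Require Import all_boot all_order all_algebra.

Set Implicit Arguments.
Unset Strict Implicit.
Unset Printing Implicit Defensive.

Import GRing.Theory.
Local Open Scope ring_scope.

(* Loopless by convention: only distinct vertices are tested. *)
Definition independent (T : finType) (adj : rel T) (A : {set T}) : bool :=
  [forall x in A, forall y in A, (x != y) ==> ~~ adj x y].

Definition independence_number (T : finType) (adj : rel T) : nat :=
  \max_(A : {set T} | independent adj A) #|A|.

Section PhaseRotation.

Variables (F : finFieldType) (n : nat).

(* Indices are shifted to start at 0: the standard basis vectors sit at
   0, ..., n - 1 and the all-ones vector at n = ord_max. *)
Definition pr_generator (i : 'I_n.+1) : 'rV[F]_n :=
  if unlift ord_max i is Some j then delta_mx 0 j else const_mx 1.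

Definition pr_line (i : 'I_n.+1) : {vspace 'rV[F]_n} := <[pr_generator i]>%VS.

(* The span of a union of subspaces is their sum. *)
Definition pr_span (I : {set 'I_n.+1}) : {vspace 'rV[F]_n} :=
  (\sum_(i in I) pr_line i)%VS.

(* The full index set is a legitimate default for the minimum, as it always
   spans; see pr_span_setT and pr_weightP. *)
Definition pr_weight (x : 'rV[F]_n) : nat :=
  #|[arg min_(I < [set: 'I_n.+1] | x \in pr_span I) #|I|]|.

Definition pr_dist (x y : 'rV[F]_n) : nat := pr_weight (x - y).

Definition pr_adj : rel 'rV[F]_n := fun x y => pr_dist x y == 1%N.

Lemma pr_span_setT (x : 'rV[F]_n) : x \in pr_span [set: 'I_n.+1].
Proof.
rewrite [x]row_sum_delta; apply: memv_suml => j _; apply: memvZ.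
have: pr_generator (lift ord_max j) \in pr_line (lift ord_max j).
  exact: memv_line.
rewrite {1}/pr_generator liftK; apply: subvP.
by apply: (sumv_sup (lift ord_max j)); rewrite ?inE.
Qed.

Lemma pr_weightP (x : 'rV[F]_n) :
  (exists2 I : {set 'I_n.+1}, x \in pr_span I & #|I| = pr_weight x) /\
  (forall I : {set 'I_n.+1}, x \in pr_span I -> (pr_weight x <= #|I|)%N).
Proof.
rewrite /pr_weight; case: arg_minnP => [|I xI minI].
  exact: pr_span_setT.
by split; first exists I.
Qed.

End PhaseRotation.

(* Main.v *)
(** Every coset of [F e_1] is a clique, so an independent set injects into
    [F^(n-1)] by dropping a coordinate; this is the bound [q^(n-1)].

    For [q = 2] and [n] even we use Hoffman's ratio bound.  The graph is the
    Cayley graph of [F_2^n] with connection set [e_1, ..., e_n, 1], so its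
    eigenvalues are [lambda_u = sum_j (-1)^(u_j) + (-1)^(sum_j u_j)].  We have
    [lambda_0 = n + 1], and the parity of [n] gives [lambda_u >= -(n - 1)]: if
    all [u_j = 1], the last sign is [+1].  If [f] is the Fourier transform of the
    indicator of an independent set of size [a], then Parseval's identity
    [sum_u f(u)^2 = 2^n a] and the independence [sum_u lambda_u f(u)^2 = 0] give
    [(n + 1) a^2 <= (n - 1) (2^n a - a^2)]. *)
Require Import Defs.
From mathcomp Require Import all_boot all_order all_algebra.
From mathcomp Require Import lra.
Import Order.TTheory GRing.Theory Num.Theory.
Local Open Scope ring_scope.

Lemma pr_weight_line {F : finFieldType} {n : nat} {i : 'I_n.+1} {x : 'rV[F]_n} :
  x \in pr_line F i -> x != 0 -> pr_weight x = 1%N.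
Proof.
move=> xi x0; have [[I xI cI] minw] := pr_weightP x.
apply/eqP; rewrite eqn_leq; apply/andP; split.
  by rewrite -(cards1 i); apply: minw; rewrite /pr_span big_set1.
rewrite -cI card_gt0; apply: contra_neq x0 => I0.
by move: xI; rewrite I0 /pr_span big_set0 memv0 => /eqP.
Qed.

(** Distinct points in a coset of a line differ by a vector of weight one, hence are adjacent. *)
Lemma independent_pr_line {F : finFieldType} {n : nat} {A : {set 'rV[F]_n}}
    (i : 'I_n.+1) {x y : 'rV[F]_n} :
  independent (@pr_adj F n) A -> x \in A -> y \in A -> x - y \in pr_line F i ->
  x = y.
Proof.
move=> /forall_inP indA xA yA xyi; apply/eqP/negP => /negP xy.
have /forall_inP/(_ y yA) := indA x xA.
by rewrite xy /pr_adj /pr_dist (pr_weight_line xyi) ?subr_eq0 ?eqxx.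
Qed.

Lemma independent_pr_clique_bound {F : finFieldType} {n : nat}
    (A : {set 'rV[F]_n.+1}) :
  independent (@pr_adj F n.+1) A -> (#|A| <= #|F| ^ n)%N.
Proof.
move=> indA; rewrite -[X in (_ <= _ ^ X)%N]mul1n -card_mx.
have inj : {in A &, injective (fun x : 'rV[F]_n.+1 => col' ord0 x)}.
  move=> x y xA yA /rowP eqxy.
  (* [lift ord_max ord0] indexes the basis vector of the coordinate that [col' ord0] drops. *)
  apply: (independent_pr_line (lift ord_max ord0) indA xA yA).
  apply/vlineP; exists (x 0 ord0 - y 0 ord0).
  rewrite /pr_generator liftK; apply/rowP => j; rewrite !mxE eqxx.
  case: (unliftP ord0 j) => [k|] -> /=; last by rewrite mulr1.
  by move: (eqxy k); rewrite !mxE => ->; rewrite subrr mulr0.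
by rewrite -(card_in_imset inj) max_card.
Qed.

Section BinaryField.

Context {F : finFieldType} (F2 : #|F| = 2%N).

Lemma card2_neq0 (x : F) : x != 0 -> x = 1.
Proof.
move=> x0; apply/eqP/negP => /negP x1.
have /subset_leq_card := subsetT [set x; 0; 1].
by rewrite -setUA !cardsU1 !inE cards1 negb_or x0 x1 cardsT F2 eq_sym oner_eq0.
Qed.

Lemma card2_addrr (x : F) : x + x = 0.
Proof.
apply/eqP/negP => /negP h; have x1 := card2_neq0 _ h.
have [x0|/card2_neq0 x0] := eqVneq x 0.
  by move: h; rewrite x0 addr0 eqxx.
by move: x1; rewrite x0 => /eqP; rewrite -subr_eq0 addrK oner_eq0.
Qed.

(** The nontrivial additive character of the two-element field, with values in an ordered field. *)
Definition sgF2 (x : F) : rat := if x == 0 then 1 else -1.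

Lemma sgF2_0 : sgF2 0 = 1.
Proof. by rewrite /sgF2 eqxx. Qed.

Lemma sgF2_1 : sgF2 1 = -1.
Proof. by rewrite /sgF2 oner_eq0. Qed.

Lemma sgF2D (x y : F) : sgF2 (x + y) = sgF2 x * sgF2 y.
Proof.
have [->|/card2_neq0 ->] := eqVneq x 0; first by rewrite add0r sgF2_0 mul1r.
have [->|/card2_neq0 ->] := eqVneq y 0; first by rewrite addr0 sgF2_0 mulr1.
by rewrite card2_addrr sgF2_0 sgF2_1 mulrNN mulr1.
Qed.

Lemma sgF2_ge (x : F) : -1 <= sgF2 x.
Proof. by rewrite /sgF2; case: ifP. Qed.

Context {n : nat}.
Implicit Types (u x y : 'rV[F]_n) (A : {set 'rV[F]_n}).

Definition chi u x : rat := sgF2 (\sum_j u 0 j * x 0 j).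

Lemma chiDr u x y : chi u (x + y) = chi u x * chi u y.
Proof.
rewrite /chi -sgF2D -big_split; congr sgF2.
by apply: eq_bigr => j _; rewrite mxE mulrDr.
Qed.

Lemma chiC u x : chi u x = chi x u.
Proof. by congr sgF2; apply: eq_bigr => j _; rewrite mulrC. Qed.

Lemma chi0l x : chi 0 x = 1.
Proof. by rewrite /chi big1 ?sgF2_0 // => j _; rewrite mxE mul0r. Qed.

Lemma chi_delta u (j : 'I_n) : chi u (delta_mx 0 j) = sgF2 (u 0 j).
Proof.
congr sgF2; rewrite (bigD1 j) //= big1 ?mxE ?eqxx ?mulr1 ?addr0 // => k kj.
by rewrite mxE (negbTE kj) andbF mulr0.
Qed.

Lemma chi_const1 u : chi u (const_mx 1) = sgF2 (\sum_j u 0 j).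
Proof. by congr sgF2; apply: eq_bigr => j _; rewrite mxE mulr1. Qed.

Lemma sum_chi x : \sum_u chi u x = if x == 0 then 2 ^+ n else 0.
Proof.
case: eqP => [->|/eqP x0].
  under eq_bigr do rewrite chiC chi0l.
  by rewrite sumr_const card_mx F2 mul1n natrX.
have /rV0Pn [j xj] := x0.
(* Translating [u] by a basis vector at which [x] has entry 1 flips the sign of every term. *)
suff : \sum_u chi u x = - \sum_u chi u x by lra.
rewrite [LHS](reindex_inj (addrI (delta_mx 0 j))) /= -sumrN.
apply: eq_bigr => u _.
by rewrite chiC chiDr chi_delta (card2_neq0 _ xj) sgF2_1 mulN1r chiC.
Qed.

Definition pr_eigenvalue u : rat := \sum_i chi u (pr_generator F i).

Lemma pr_eigenvalueE u :
  pr_eigenvalue u = \sum_j sgF2 (u 0 j) + sgF2 (\sum_j u 0 j).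
Proof.
rewrite /pr_eigenvalue (bigD1_ord ord_max) //= addrC; congr (_ + _).
  by apply: eq_bigr => j _; rewrite /pr_generator liftK chi_delta.
by rewrite /pr_generator unlift_none chi_const1.
Qed.

Lemma pr_eigenvalue0 : pr_eigenvalue 0 = n%:R + 1.
Proof.
rewrite /pr_eigenvalue; under eq_bigr do rewrite chi0l.
by rewrite sumr_const card_ord -natr1.
Qed.

Lemma pr_eigenvalue_ge u : ~~ odd n -> 1 - n%:R <= pr_eigenvalue u.
Proof.
move=> evn; rewrite pr_eigenvalueE.
(* A zero coordinate contributes 1; the other n - 1 coordinates and the last sign are each at least
   -1, for a total of at least 1 - n. *)
have [j uj|u1] := pickP (fun j => u 0 j == 0).
  rewrite (bigD1 j) //= (eqP uj) sgF2_0.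
  have := sgF2_ge (\sum_j u 0 j).
  have : \sum_(i < n | i != j) -1 <= \sum_(i < n | i != j) sgF2 (u 0 i).
    by apply: ler_sum => i _; apply: sgF2_ge.
  rewrite sumr_const cardC1 card_ord mulNrn.
  have : n.-1%:R + 1 = n%:R :> rat.
    by rewrite natr1 prednK // (leq_ltn_trans _ (ltn_ord j)).
  lra.
(* Otherwise the coordinates contribute -n, and the last sign is 1 since an even number of ones sums
   to 0. *)
have uE j : u 0 j = 1 by apply: card2_neq0; rewrite u1.
under eq_bigr do rewrite uE sgF2_1.
under [X in _ + sgF2 X]eq_bigr do rewrite uE.
rewrite !sumr_const card_ord -[X in sgF2 (_ *+ X)]even_halfK //.
rewrite -addnn mulrnDr card2_addrr sgF2_0 mulNrn; lra.
Qed.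

Definition fourier A u : rat := \sum_(x in A) chi u x.

Lemma fourier0 A : fourier A 0 = #|A|%:R.
Proof. by rewrite /fourier; under eq_bigr do rewrite chi0l; rewrite sumr_const. Qed.

(** Expand the square and use orthogonality of characters. Taking [x = 0] yields Parseval, and
    taking [x] a generator counts adjacent pairs. *)
Lemma sum_chi_fourier_sqr A x :
  \sum_u chi u x * fourier A u ^+ 2 =
  \sum_(y in A) \sum_(z in A) if y + z + x == 0 then 2 ^+ n else 0.
Proof.
transitivity (\sum_u \sum_(y in A) \sum_(z in A) chi u (y + z + x)).
  apply: eq_bigr => u _; rewrite expr2 mulrC /fourier !mulr_suml.
  apply: eq_bigr => y _; rewrite mulr_sumr mulr_suml.
  by apply: eq_bigr => z _; rewrite !chiDr.
rewrite exchange_big; apply: eq_bigr => y _.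
by rewrite exchange_big; apply: eq_bigr => z _; rewrite sum_chi.
Qed.

Lemma rV_card2_addr_eq0 x y : (x + y == 0) = (x == y).
Proof.
have oppy : - y = y.
  by apply/rowP => j; rewrite mxE; apply/esym/eqP; rewrite -addr_eq0 card2_addrr.
by rewrite addr_eq0 oppy.
Qed.

Lemma parseval A : \sum_u fourier A u ^+ 2 = 2 ^+ n * #|A|%:R.
Proof.
have := sum_chi_fourier_sqr A 0; under eq_bigr do rewrite chiC chi0l mul1r.
move=> ->; rewrite mulr_natr -sumr_const; apply: eq_bigr => y yA.
under eq_bigr do rewrite addr0 rV_card2_addr_eq0.
rewrite (bigD1 y) //= eqxx big1 ?addr0 // => z /andP[_ zy].
by rewrite eq_sym (negbTE zy).
Qed.

Lemma pr_generator_neq0 (i : 'I_n.+1) : (0 < n)%N -> pr_generator F i != 0.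
Proof.
move=> n0; rewrite /pr_generator; case: (unlift _ _) => [j|]; apply/rV0Pn.
  by exists j; rewrite mxE !eqxx oner_eq0.
by exists (Ordinal n0); rewrite mxE oner_eq0.
Qed.

Lemma sum_pr_eigenvalue_fourier A :
  (0 < n)%N -> independent (@pr_adj F n) A ->
  \sum_u pr_eigenvalue u * fourier A u ^+ 2 = 0.
Proof.
move=> n0 indA; under eq_bigr do rewrite mulr_suml.
rewrite exchange_big big1 //= => i _; rewrite sum_chi_fourier_sqr.
rewrite big1 // => y yA; rewrite big1 // => z zA; case: eqP => // yzi.
have gi : pr_generator F i = y + z.
  by apply/esym/eqP; rewrite -rV_card2_addr_eq0 yzi.
have subE : y - z = y + z.
  by congr (_ + _); apply/eqP; rewrite eq_sym -addr_eq0 rV_card2_addr_eq0.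
(* In characteristic 2 the generator is also [y - z], so independence forces [y = z] and the
   generator would vanish. *)
have yz : y = z.
  apply: (independent_pr_line i indA yA zA).
  by rewrite subE -gi memv_line.
have := pr_generator_neq0 i n0.
by rewrite gi yz rV_card2_addr_eq0 eqxx.
Qed.

Lemma independent_pr_hoffman A :
  (0 < n)%N -> ~~ odd n -> independent (@pr_adj F n) A ->
  2 * n%:R * #|A|%:R <= (n%:R - 1) * 2 ^+ n :> rat.
Proof.
move=> n0 evn indA; have [->|A0] := eqVneq A set0.
  by rewrite cards0 mulr0 mulr_ge0 ?exprn_ge0 // subr_ge0 ler1n.
have a0 : 0 < #|A|%:R :> rat by rewrite ltr0n card_gt0.
have := sum_pr_eigenvalue_fourier A n0 indA.
have := parseval A.
rewrite (bigD1 0) // [X in _ -> X = _ -> _](bigD1 0) //=.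
rewrite fourier0 pr_eigenvalue0.
have : \sum_(u | u != 0) (1 - n%:R) * fourier A u ^+ 2
    <= \sum_(u | u != 0) pr_eigenvalue u * fourier A u ^+ 2.
  by apply: ler_sum => u _; rewrite ler_wpM2r ?sqr_ge0 ?pr_eigenvalue_ge.
rewrite -mulr_sumr; move: (\sum_(u | _) _ * _) (\sum_(u | _) _) => s t.
move=> le_s /(canRL (addKr _)) tE sE.
(* After multiplying the goal by a = [#|A|], it follows from (n + 1) a^2 + s = 0 and s >= (1 - n)
   (2^n a - a^2), as the coefficients of a^2 combine to 2n. *)
rewrite -(ler_pM2r a0); move: le_s; rewrite tE; move: sE.
set a := #|A|%:R; set N := n%:R; set p := 2 ^+ n => sE le_s; nra.
Qed.

End BinaryField.

Theorem theorem37 (q n : nat) (F : finFieldType) (hq : #|F| = q)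
    (hn : (2 <= n)%N) :
  (q = 2%N /\ ~~ odd n ->
     (independence_number (@pr_adj F n))%:R
       <= 2 ^+ (n - 1) * ((n%:R - 1) / n%:R) :> rat) /\
  ((q = 2%N /\ odd n) \/ (3 <= q)%N ->
     (independence_number (@pr_adj F n) <= q ^ (n - 1))%N).
Proof.
have n0 : (0 < n)%N by apply: ltnW.
split=> [[q2 evn]|_].
  rewrite q2 in hq; pose P k := k%:R <= 2 ^+ (n - 1) * ((n%:R - 1) / n%:R) :> rat.
  (* The rational bound passes to the maximum: it holds for the default 0, is stable under [maxn],
     and holds for each independent set. *)
  apply: (big_ind P) => [|k l Pk Pl|A indA]; rewrite /P.
  - by rewrite mulr_ge0 ?exprn_ge0 ?divr_ge0 ?ler0n // subr_ge0 ler1n.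
  - by rewrite /maxn; case: ifP.
  - have := independent_pr_hoffman hq A n0 evn indA.
    rewrite mulrA ler_pdivlMr ?ltr0n // -[X in 2 ^+ X](subnK n0) exprD expr1; lra.
case: n hn n0 => // n _ _; apply/bigmax_leqP => A indA.
by rewrite subn1 -hq independent_pr_clique_bound.
Qed.
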